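(* Let $G$ be a locally compact Abelian group and let $\Omega_{+},\Omega_{-}\subset G$ be boundary-coherent symmetric subsets with $\Omega_{+}$ a neighbourhood of $0$. Then $\mathcal{F}^{*}_{G}(\overline{\Omega_{+}},\overline{\Omega_{-}})=\mathcal{F}_{G}(\Omega_{+},\Omega_{-})$.
   Context: All locally compact Abelian (LCA) groups are Hausdorff, written additively with identity $0$, and $\lambda_G$ denotes a fixed Haar measure on $G$. A set $\Omega\subset G$ is symmetric if $\Omega=-\Omega$. A neighbourhood of $0$ is a set containing an open set that contains $0$. Here $A \subset B$ does not mean strict inclusion. A function $f:G\to\mathbb{R}$ is positive definite if $\sum_{i=1}^{n}\sum_{j=1}^{n}c_i\overline{c_j}f(g_i-g_j)\ge 0$ for all $n\in\mathbb{N}$, $c_i\in\mathbb{C}$, $g_i\in G$. $P_1(G)$ is the set of continuous positive definite functions $f:G\to\mathbb{R}$ with $f(0)=1$. Write $f_+:=\max\{f,0\}$, $f_-:=\max\{-f,0\}$, and $\operatorname{supp} f:=\overline{\{g\in G: f(g)\neq 0\}}$. For subsets $\Omega_+,\Omega_-\subset G$, $$\mathcal{F}_{G}(\Omega_{+},\Omega_{-}):=\{f\in P_1(G)\cap L^1(G): f^{-1}((0,\infty))\subset\Omega_{+},\ f^{-1}((-\infty,0))\subset\Omega_{-}\},$$ $$\mathcal{F}^{*}_{G}(\Omega_{+},\Omega_{-}):=\{f\in P_1(G)\cap L^1(G): \operatorname{supp} f_+\subset\Omega_{+},\ \operatorname{supp} f_-\subset\Omega_{-}\}.$$ A subset $\Omega$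 of a topological space $X$ is boundary-coherent if $\partial\Omega\subset\overline{\operatorname{ext}\Omega}$, where $\operatorname{ext}\Omega:=X\setminus\overline{\Omega}$. *)

(* Defs.v *)
From HB Require Import structures.
From mathcomp Require Import all_boot all_order all_algebra.
From mathcomp Require Import complex.
From mathcomp Require Import all_classical all_reals all_analysis.
Set Implicit Arguments.
Unset Strict Implicit.
Unset Printing Implicit Defensive.
Import Order.TTheory GRing.Theory Num.Theory.
Import numFieldNormedType.Exports.
Local Open Scope classical_set_scope.
Local Open Scope ring_scope.
Local Open Scope complex_scope.

(* A measurableType must be pointed, which a topologicalZmodType is not: the
   carrier is renamed, pointed at 0 and given its Borel sigma-algebra. *)
Definition borel (G : topologicalZmodType) : Type := G.

HB.instance Definition _ (G : topologicalZmodType) := Choice.on (borel G).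
HB.instance Definition _ (G : topologicalZmodType) :=
  isPointed.Build (borel G) (0 : G).
HB.instance Definition _ (G : topologicalZmodType) :=
  Measurable.copy (borel G)
    (g_sigma_algebraType (@open G : set (set (borel G)))).

Section lca_group.
Variables (R : realType) (G : topologicalZmodType).

(* Nonzero translation-invariant Radon measure; "Radon" is taken as finite on
   compact sets, outer regular on Borel sets and inner regular on open sets. *)
Record haar_measure (mu : {measure set (borel G) -> \bar R}) : Prop := {
  haar_neq0 : (0 < mu setT)%E ;
  haar_invariant : forall (x : G) (A : set (borel G)), measurable A ->
    mu [set x + a | a in A] = mu A ;
  haar_compact : forall K : set G, compact K -> (mu K < +oo)%E ;
  haar_outer : forall A : set (borel G), measurable A ->
    mu A = ereal_inf [set mu U | U in [set U : set G | open U /\ A `<=` U]] ;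
  haar_inner : forall U : set G, open U ->
    mu U = ereal_sup [set mu K | K in [set K : set G | compact K /\ K `<=` U]]
}.

Definition positive_definite (f : G -> R) : Prop :=
  forall (n : nat) (c : 'I_n -> R[i]) (g : 'I_n -> G),
    0 <= \sum_(i < n) \sum_(j < n) c i * (c j)^*%C * (f (g i - g j))%:C.

Definition P1 : set (G -> R) :=
  [set f : G -> R | [/\ continuous f, positive_definite f & f 0 = 1]].

(* Integrable functions themselves, not classes modulo a.e. equality. *)
Definition L1 (mu : {measure set (borel G) -> \bar R}) : set (G -> R) :=
  [set f : G -> R | mu.-integrable setT (EFin \o (f : borel G -> R))].

Definition supp (f : G -> R) : set G := closure [set g | f g != 0].

Definition F (mu : {measure set (borel G) -> \bar R}) (Op Om : set G) :
    set (G -> R) :=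
  [set f : G -> R | [/\ (P1 `&` L1 mu) f,
     f @^-1` `]0, +oo[ `<=` Op & f @^-1` `]-oo, 0[ `<=` Om]].

Definition Fstar (mu : {measure set (borel G) -> \bar R}) (Op Om : set G) :
    set (G -> R) :=
  [set f : G -> R | [/\ (P1 `&` L1 mu) f, supp f^\+ `<=` Op & supp f^\- `<=` Om]].

End lca_group.

Definition symmetric_set (G : zmodType) (A : set G) : Prop :=
  A = [set - a | a in A].

Definition boundary (X : topologicalType) (A : set X) : set X :=
  closure A `\` A°.

Definition exterior (X : topologicalType) (A : set X) : set X :=
  ~` closure A.

Definition boundary_coherent (X : topologicalType) (A : set X) : Prop :=
  boundary A `<=` closure (exterior A).

(* Main.v *)
Require Import Defs.
From mathcomp Require Import all_boot all_order all_algebra.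
From mathcomp Require Import all_classical all_reals all_analysis.
Import Order.TTheory GRing.Theory Num.Theory.
Import numFieldNormedType.Exports.
Local Open Scope classical_set_scope.
Local Open Scope ring_scope.

(* An open subset of the closure of A misses the exterior of A, hence also the
   closure of the exterior; when A is boundary-coherent it therefore avoids the
   boundary of A. This applies to {f > 0} and {f < 0}, whose closures are the
   supports of the positive and negative parts of f. *)

Lemma closure_sub_boundary_coherent (X : topologicalType) (A V : set X) :
  boundary_coherent A -> open V -> (closure V `<=` closure A) <-> (V `<=` A).
Proof.
move=> coA oV; split=> [VA x Vx|]; last exact: closureS.
have {}VA : V `<=` closure A by move=> y /subset_closure /VA.
apply: contrapT => nAx.
(* Being in [closure A] but outside [A], the point [x] cannot be interior to [A]. *)
have bAx : boundary A x by split; [exact: VA | move/interior_subset].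
(* Coherence puts [x] in the closure of the exterior, so its neighbourhood [V] contains an exterior
   point [y], against [VA]. *)
have [y [extAy Vy]] := coA _ bAx V (open_nbhs_nbhs (conj oV Vx)).
exact/extAy/VA.
Qed.

(** Used at [a = f x] and [a = - f x] to turn the nonvanishing of [f^\+] and [f^\-] into sign
    conditions on [f]. *)
Lemma max0_neq0 (R : realDomainType) (a : R) : (Num.max a 0 != 0) = (0 < a).
Proof.
by rewrite /Num.max; case: ltgtP => [_|/lt0r_neq0|->]; rewrite ?eqxx.
Qed.

Lemma supp_funrpos (R : realType) (G : topologicalZmodType) (f : G -> R) :
  supp f^\+ = closure (f @^-1` `]0, +oo[).
Proof.
congr closure; apply/seteqP.
by split=> x /=; rewrite in_itv /= andbT /funrpos max0_neq0.
Qed.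

Lemma supp_funrneg (R : realType) (G : topologicalZmodType) (f : G -> R) :
  supp f^\- = closure (f @^-1` `]-oo, 0[).
Proof.
congr closure; apply/seteqP.
by split=> x /=; rewrite in_itv /= /funrneg max0_neq0 oppr_gt0.
Qed.

Theorem proposition24 (R : realType) (G : topologicalZmodType)
    (G_hausdorff : hausdorff_space G)
    (G_locally_compact : locally_compact [set: G])
    (lambda : {measure set (borel G) -> \bar R})
    (lambda_haar : haar_measure lambda)
    (Op Om : set G)
    (Op_coherent : boundary_coherent Op) (Om_coherent : boundary_coherent Om)
    (Op_symmetric : symmetric_set Op) (Om_symmetric : symmetric_set Om)
    (Op_nbhs0 : nbhs (0 : G) Op) :
  Fstar lambda (closure Op) (closure Om) = F lambda Op Om.
Proof.
have openf (f : G -> R) (I : set R) : continuous f -> open I -> open (f @^-1` I).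
  by move=> /continuousP; apply.
apply/seteqP; split=> f [fP1L1]; have [[cf _ _] _] := fP1L1.
(* Continuity of [f] makes both sign sets open, as preimages of open rays, so coherence removes the
   closures on both sides. *)
- rewrite supp_funrneg supp_funrpos => fp fm; split=> //;
    apply/closure_sub_boundary_coherent => //;
    by apply: openf => //; exact: interval_open.
- move=> fp fm; split=> //.
    by rewrite supp_funrpos; exact: closureS.
  by rewrite supp_funrneg; exact: closureS.
Qed.
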